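(* Let $F$ satisfy the DLRA assumptions and the affine assumption described in the context, and let $E_n^k = X_n - Y_n^k$ be the error of low-rank Parareal with coarse rank $q$, fine rank $r$ ($q<r$) and step size $h$. Put $$\alpha = e^{\ell h} C_{r,q},\qquad \beta = e^{\ell h} C_q,\qquad \kappa = e^{\ell h}\max_{n\ge 0}\|X_n-\mathcal{T}_r(X_n)\| + (2\varepsilon_q+\varepsilon_r)\int_0^h e^{\ell(h-s)}\,ds .$$ If $\alpha+\beta<1$, then the error of low-rank Parareal satisfies for all $n,k\in\mathbb{N}$ the bound $$\|E_n^k\| \le \alpha^k(1+\beta)^{n-1}\max_{n\ge 0}\|E_n^0\| + \frac{\kappa}{1-\alpha-\beta}.$$
   Context: Notation: $\|\cdot\|$ is the Frobenius norm on $\mathbb{R}^{m\times m}$ and $\langle\cdot,\cdot\rangle$ the corresponding inner product. A superscript $k$ on $Y,E$ is an iteration index, not a power; $\alpha^k$ and $(1+\beta)^{n-1}$ denote powers. Full problem: $\dot X(t)=F(X(t))$ on $[0,T]$, $X(0)=X_0\in\mathbb{R}^{m\times m}$, with constant time step $h$, $T=Nh$, $t_n=nh$ and $X_n=X(t_n)$. The index $n$ is the time-step index. Affine assumption: $F$ is affine linear and autonomous, $F(X)=A(X)+B$ with $A:\mathbb{R}^{m\times m}\to\mathbb{R}^{m\times m}$ a linear operator and $B\in\mathbb{R}^{m\times m}$. DLRA: for a rank $p$, let $\mathcal{M}_p$ be the manifold of $m\times m$ matrices of rank $p$, and for $Y\in\mathcal{M}_p$ let $\mathcal{P}_Y$ be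 the $l_2$-orthogonal projection onto the tangent space of $\mathcal{M}_p$ at $Y$. The dynamical low-rank approximation (DLRA) of rank $p$ is the solution of $\dot Y(t)=\mathcal{P}_{Y(t)}F(Y(t))$ with initial value in $\mathcal{M}_p$; $\psi_p^h(Z)$ denotes this solution at time $h$ with initial value $Z$. $\mathcal{T}_p$ denotes the orthogonal projection onto $\mathcal{M}_p$ (truncated SVD). DLRA assumptions: for all $X,Y\in\mathbb{R}^{m\times m}$, $\|F(X)-F(Y)\|\le L\|X-Y\|$ (Lipschitz with constant $L$) and $\langle X-Y,F(X)-F(Y)\rangle\le \ell\|X-Y\|^2$ (one-sided Lipschitz with constant $\ell$); and, for $p\in\{q,r\}$, $\|F(Y)-\mathcal{P}_YF(Y)\|\le\varepsilon_p$ for $Y\in\mathcal{M}_p$ (modeling error). Low-rank Parareal: for ranks $q<r$ and a given initial matrix $Y_0$, the iterates $Y_n^k$ are defined by $Y_0^k=Y_0$; $Y_{n+1}^0=\psi_q^h(\mathcal{T}_q(Y_n^0))+\mathcal{E}_n$, where the matrices $\mathcal{E}_n$ are small perturbations such that $\mathrm{rank}(Y_{n+1}^0)=r+2q$ and can be chosen randomly; and $$Y_{n+1}^{k+1}=\psi_r^h(\mathcal{T}_r(Y_n^k))+\psi_q^h(\mathcal{T}_q(Y_n^{k+1}))-\psi_q^h(\mathcal{T}_q(Y_n^k)).$$ Lipschitz constants: $C_{r,q}$ and $C_q$ are the Lipschitz constants of $\mathcal{T}_r-\mathcal{T}_q$ and of $\mathcal{T}_q$, respectively.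
   Formalization: The initial matrix Y_0 is assumed to satisfy T_r(Y_0) = T_r(X_0), and the bound at n = 0 is claimed only when Y_0 = X_0; for a Y_0 unrelated to X_0 the bound fails as k grows, since E_0^k does not depend on k. *)

(* Defs.v *)
From HB Require Import structures.
From mathcomp Require Import all_boot all_order all_algebra.
From mathcomp Require Import all_classical all_reals all_analysis.

Set Implicit Arguments.
Unset Strict Implicit.
Unset Printing Implicit Defensive.

Import Order.TTheory GRing.Theory Num.Theory.
Import numFieldNormedType.Exports.

Local Open Scope classical_set_scope.
Local Open Scope ring_scope.

(* The library norm on matrices is the max norm, so the Frobenius norm has its
   own name here. Limits and derivatives of matrix-valued maps are the library
   ones; in finite dimension they do not depend on the norm. *)
Definition fdot (R : realType) (m : nat) (A B : 'M[R]_m) : R :=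
  \sum_(i < m) \sum_(j < m) A i j * B i j.

Definition fnorm (R : realType) (m : nat) (A : 'M[R]_m) : R :=
  Num.sqrt (fdot A A).

Definition fixed_rank (R : realType) (m p : nat) : set 'M[R]_m :=
  [set Y | \rank Y = p].

(* The set of fixed-rank matrices is an embedded submanifold, so its tangent
   space is the set of velocities of curves lying in it. *)
Definition tangent (R : realType) (m p : nat) (Y : 'M[R]_m) : set 'M[R]_m :=
  [set V | exists g : R -> 'M[R]_m,
     [/\ g 0 = Y,
         (\forall t \near (0 : R), fixed_rank p (g t)) &
         is_derive (0 : R) 1 g V]].

Definition tangent_proj (R : realType) (m p : nat) (Y Z : 'M[R]_m) : 'M[R]_m :=
  xget 0 [set W | tangent p Y W /\
                  forall V, tangent p Y V -> fdot (Z - W) V = 0].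

Definition ode_solution (R : realType) (m : nat) (f : 'M[R]_m -> 'M[R]_m)
    (T : R) (X : R -> 'M[R]_m) : Prop :=
  {within `[0, T], continuous X} /\
  (forall t : R, 0 < t < T -> is_derive t 1 X (f (X t))).

Definition dlra_solution (R : realType) (m p : nat) (F : 'M[R]_m -> 'M[R]_m)
    (h : R) (Z : 'M[R]_m) (Y : R -> 'M[R]_m) : Prop :=
  [/\ Y 0 = Z,
      (forall t : R, 0 <= t <= h -> fixed_rank p (Y t)) &
      ode_solution (fun W => tangent_proj p W (F W)) h Y].

(* A solution may reach the boundary of the manifold before time h, so the
   flow is partial; it takes the value 0 where no solution exists on [0, h]. *)
Definition dlra_flow (R : realType) (m p : nat) (F : 'M[R]_m -> 'M[R]_m)
    (h : R) (Z : 'M[R]_m) : 'M[R]_m :=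
  xget 0 [set W | exists2 Y, dlra_solution p F h Z Y & Y h = W].

(* T is the truncated SVD of rank p, for some selection of a nearest point when
   singular values coincide. A matrix of rank less than p has no nearest point
   of rank exactly p; its truncated SVD is itself. *)
Definition truncation (R : realType) (m p : nat) (T : 'M[R]_m -> 'M[R]_m) :
    Prop :=
  forall Z : 'M[R]_m,
    if (p <= \rank Z)%N
    then fixed_rank p (T Z) /\
         forall W, fixed_rank p W -> fnorm (Z - T Z) <= fnorm (Z - W)
    else T Z = Z.

Definition frobenius_lipschitz (R : realType) (m : nat) (D : set 'M[R]_m)
    (f : 'M[R]_m -> 'M[R]_m) (C : R) : Prop :=
  0 <= C /\
  forall Z W, D Z -> D W -> fnorm (f Z - f W) <= C * fnorm (Z - W).

Definition one_sided_lipschitz (R : realType) (m : nat)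
    (f : 'M[R]_m -> 'M[R]_m) (l : R) : Prop :=
  forall Z W, fdot (Z - W) (f Z - f W) <= l * fnorm (Z - W) ^+ 2.

Definition modeling_error (R : realType) (m p : nat)
    (F : 'M[R]_m -> 'M[R]_m) (eps : R) : Prop :=
  forall Y, fixed_rank p Y -> fnorm (F Y - tangent_proj p Y (F Y)) <= eps.

(* [Y n k] is the k-th iterate at time step n; P n is the perturbation added to
   the initial coarse sweep. *)
Definition lowrank_parareal (R : realType) (m q r N : nat)
    (F Tq Tr : 'M[R]_m -> 'M[R]_m) (h : R) (Y0 : 'M[R]_m)
    (P : nat -> 'M[R]_m) (Y : nat -> nat -> 'M[R]_m) : Prop :=
  let psi p := dlra_flow p F h in
  [/\ (forall k, Y 0%N k = Y0),
      (forall n, (n < N)%N -> Y n.+1 0%N = psi q (Tq (Y n 0%N)) + P n),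
      (forall n, (n < N)%N -> \rank (Y n.+1 0%N) = (r + 2 * q)%N) &
      (forall n k, (n < N)%N ->
         Y n.+1 k.+1 =
           psi r (Tr (Y n k)) + psi q (Tq (Y n k.+1)) - psi q (Tq (Y n k)))].

(* Every subproblem that the iteration solves has a solution on [0, h]. *)
Definition parareal_well_defined (R : realType) (m q r N : nat)
    (F Tq Tr : 'M[R]_m -> 'M[R]_m) (h : R)
    (Y : nat -> nat -> 'M[R]_m) : Prop :=
  forall n k, (n < N)%N ->
    (exists Z, dlra_solution r F h (Tr (Y n k)) Z) /\
    (exists Z, dlra_solution q F h (Tq (Y n k)) Z).

(* Main.v *)
Require Import Defs.
From HB Require Import structures.
From mathcomp Require Import all_boot all_order all_algebra.
From mathcomp Require Import all_classical all_reals all_analysis.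
From mathcomp Require Import ring lra.

Set Implicit Arguments.
Unset Strict Implicit.
Unset Printing Implicit Defensive.

Import Order.TTheory GRing.Theory Num.Theory.
Import numFieldNormedType.Exports.

Local Open Scope classical_set_scope.
Local Open Scope ring_scope.

(** Write [e n k] for the norm of the error. The bound follows from
      [e n.+1 k.+1 <= alpha * e n k + beta * e n k.+1 + kappa].
    Rather than comparing each low-rank flow with an exact flow of [F] started
    at the same matrix, the proof makes one comparison, for the combination
      [U t = X (t_n + t) - Zr t - Zq t + Zq' t]
    of the exact solution with the three low-rank solutions that enter one
    update. The coefficients sum to zero, so the constant part of [F] cancels
    and [U' = A U + d], where [d] collects three modeling errors and has norm
    at most [2 * epsq + epsr]. The one-sided Lipschitz condition for an affine
    [F] reads [<U, A U> <= l * |U|^2], and a Gronwall estimate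
    ([gronwall_fnorm]) bounds [U h], which is the new error, by [U 0] plus the
    integral term of [kappa] ([parareal_defect]). At time 0,
      [U 0 = (X_n - Tr X_n) + ((Tr - Tq) X_n - (Tr - Tq) Y_n^k)
             + (Tq X_n - Tq Y_n^k.+1)],
    and the Lipschitz constants of the truncations give the recursion.

    At the first step all [Y 0 k] agree and [Tr Y0 = Tr X0], so
    [U 0 = X_0 - Tr X_0] and [e 1 k.+1 <= kappa]: no initial error is
    propagated. A double induction ([double_recursion_bound]) then gives the
    bound, because [kappa / (1 - alpha - beta)] is the fixed point of the
    recursion and [alpha^k (1 + beta)^n] solves its homogeneous part. *)

(** * Frobenius inner product and norm *)

Section Frobenius.
Context (R : realType) (m : nat).
Implicit Types (U V W : 'M[R]_m) (a : R).

Lemma fdotC U V : fdot U V = fdot V U.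
Proof. by apply: eq_bigr => i _; apply: eq_bigr => j _; rewrite mulrC. Qed.

Lemma fdotDr U V W : fdot U (V + W) = fdot U V + fdot U W.
Proof.
rewrite -big_split; apply: eq_bigr => i _; rewrite -big_split.
by apply: eq_bigr => j _; rewrite mxE mulrDr.
Qed.

Lemma fdotZr a U V : fdot U (a *: V) = a * fdot U V.
Proof.
rewrite mulr_sumr; apply: eq_bigr => i _; rewrite mulr_sumr.
by apply: eq_bigr => j _; rewrite mxE mulrCA.
Qed.

Lemma fdotNr U V : fdot U (- V) = - fdot U V.
Proof. by rewrite -scaleN1r fdotZr mulN1r. Qed.

Lemma fdotDl U V W : fdot (U + V) W = fdot U W + fdot V W.
Proof. by rewrite !(fdotC _ W) fdotDr. Qed.

Lemma fdotZl a U V : fdot (a *: U) V = a * fdot U V.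
Proof. by rewrite !(fdotC _ V) fdotZr. Qed.

Lemma fdotNl U V : fdot (- U) V = - fdot U V.
Proof. by rewrite !(fdotC _ V) fdotNr. Qed.

Lemma fdot_ge0 U : 0 <= fdot U U.
Proof. by do 2!apply: sumr_ge0 => ? _; rewrite -expr2 sqr_ge0. Qed.

Lemma fdot0r U : fdot U 0 = 0.
Proof. by rewrite -(scale0r U) fdotZr mul0r. Qed.

Lemma fdot_eq0 U : fdot U U = 0 -> U = 0.
Proof.
have rge0 i : 0 <= \sum_j U i j * U i j.
  by apply: sumr_ge0 => j _; rewrite -expr2 sqr_ge0.
move=> U0; apply/matrixP => i j; rewrite mxE; apply/eqP.
rewrite -sqrf_eq0 expr2; apply/eqP.
have Ui0 : \sum_j U i j * U i j = 0.
  by apply: (psumr_eq0P (P := xpredT) _ U0).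
by apply: (psumr_eq0P (P := xpredT) _ Ui0) => // k _; rewrite -expr2 sqr_ge0.
Qed.

Lemma fnorm_ge0 U : 0 <= fnorm U.
Proof. exact: sqrtr_ge0. Qed.

Lemma sqr_fnorm U : fnorm U ^+ 2 = fdot U U.
Proof. by rewrite sqr_sqrtr// fdot_ge0. Qed.

Lemma fnorm0 : fnorm (0 : 'M[R]_m) = 0.
Proof. by rewrite /fnorm fdot0r sqrtr0. Qed.

Lemma fnormN U : fnorm (- U) = fnorm U.
Proof. by rewrite /fnorm fdotNl fdotNr opprK. Qed.

(** Cauchy-Schwarz, by expanding the square of [|V| U - |U| V]. *)
Lemma fdot_le_fnormM U V : fdot U V <= fnorm U * fnorm V.
Proof.
have [U0|Un0] := eqVneq (fnorm U) 0.
  have -> : U = 0 by apply: fdot_eq0; rewrite -sqr_fnorm U0 expr0n.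
  by rewrite fnorm0 mul0r fdotC fdot0r.
have [V0|Vn0] := eqVneq (fnorm V) 0.
  have -> : V = 0 by apply: fdot_eq0; rewrite -sqr_fnorm V0 expr0n.
  by rewrite fnorm0 mulr0 fdot0r.
have UVgt0 : 0 < fnorm U * fnorm V.
  by rewrite mulr_gt0// lt0r ?Un0 ?Vn0 fnorm_ge0.
have := fdot_ge0 (fnorm V *: U - fnorm U *: V).
rewrite !(fdotDl, fdotDr, fdotNl, fdotNr, fdotZl, fdotZr) (fdotC V U).
rewrite -!sqr_fnorm => ?; rewrite -(ler_pM2l UVgt0); lra.
Qed.

Lemma fnormD U V : fnorm (U + V) <= fnorm U + fnorm V.
Proof.
rewrite -(@ler_pXn2r _ 2)// ?nnegrE ?addr_ge0 ?fnorm_ge0//.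
rewrite sqr_fnorm fdotDl !fdotDr (fdotC V U) -!sqr_fnorm.
have := fdot_le_fnormM U V; lra.
Qed.

Lemma fnormB U V : fnorm (U - V) <= fnorm U + fnorm V.
Proof. by rewrite -(fnormN V) fnormD. Qed.

Lemma is_derive_coord (U : R -> 'M[R]_m) (dU : 'M[R]_m) (t : R) i j :
  is_derive t 1 U dU -> is_derive t 1 (fun x => U x i j) (dU i j).
Proof.
move=> [U' <-]; rewrite derive_mx// mxE.
by apply: derivableP; move/derivable_mxP : U'; exact.
Qed.

(** The squared Frobenius norm is a finite sum of products of coordinates, which
    transfers calculus on matrices (normed by their largest entry) to it. *)
Lemma is_derive_fdot (U : R -> 'M[R]_m) (dU : 'M[R]_m) (t : R) :
  is_derive t 1 U dU ->
  is_derive t 1 (fun x => fdot (U x) (U x)) (2 * fdot (U t) dU).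
Proof.
move=> Ut.
have -> : (fun x => fdot (U x) (U x)) =
    \sum_(i < m) \sum_(j < m) ((fun x => U x i j) * (fun x => U x i j)).
  apply/funext => x; rewrite fct_sumE; apply: eq_bigr => i _.
  by rewrite fct_sumE.
apply: is_derive_eq.
  apply: is_derive_sum => i; apply: is_derive_sum => j.
  exact: is_deriveM (is_derive_coord i j Ut) (is_derive_coord i j Ut).
rewrite mulr_sumr; apply: eq_bigr => i _; rewrite mulr_sumr.
by apply: eq_bigr => j _; rewrite /GRing.scale/=; ring.
Qed.

Lemma continuous_fdot (T : topologicalType) (U : T -> 'M[R]_m) :
  continuous U -> continuous (fun x => fdot (U x) (U x)).
Proof.
move=> cU.
have cD (f g : T -> R) : continuous f -> continuous g -> continuous (f + g).
  by move=> cf cg x; apply: cvgD; [exact: cf|exact: cg].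
have c0 : continuous (0 : T -> R) by move=> x; exact: cvg_cst.
have -> : (fun x => fdot (U x) (U x)) =
    \sum_(i < m) \sum_(j < m) ((fun x => U x i j) * (fun x => U x i j)).
  apply/funext => x; rewrite fct_sumE; apply: eq_bigr => i _.
  by rewrite fct_sumE.
have cUij i j : continuous (fun x => U x i j).
  move=> x; apply: (continuous_comp (g := fun M : 'M[R]_m => M i j)).
    exact: cU.
  exact: coord_continuous.
elim/big_ind : _ => // i _; elim/big_ind : _ => // j _ x.
by apply: cvgM; exact: cUij.
Qed.

End Frobenius.

(** * A Gronwall estimate in the Frobenius norm *)

(** The primitive of [s |-> expR (- l * s)] vanishing at 0, with the removable
    singularity at [l = 0] filled in. *)
Definition exp_primitive (R : realType) (l t : R) : R :=
  if l == 0 then t else (1 - expR (- l * t)) / l.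

Section Gronwall.
Context (R : realType).
Implicit Types (l h t : R).

Lemma is_derive_expRM l t :
  is_derive t 1 (fun s => expR (l * s)) (l * expR (l * t)).
Proof.
have H : is_derive t 1 (fun s : R => l * s) l.
  by apply: is_derive_eq; rewrite /GRing.scale/= mulr1.
by apply: is_derive_eq (is_derive1_comp (is_derive_expR _) H) _; rewrite mulrC.
Qed.

Lemma is_derive_exp_primitive l t :
  is_derive t 1 (exp_primitive l) (expR (- l * t)).
Proof.
rewrite /exp_primitive; have [->|l0] := eqVneq l 0.
  by rewrite oppr0 mul0r expR0; exact: is_derive_id.
have H := is_derive_expRM (- l) t.
have -> : (fun s => (1 - expR (- l * s)) / l) =
   l^-1 *: (cst 1 - (fun s => expR (- l * s))).
  by apply/funext => s; rewrite /GRing.scale/= mulrC.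
by apply: is_derive_eq; rewrite sub0r /GRing.scale/= mulNr opprK mulKf.
Qed.

Lemma exp_primitive0 l : exp_primitive l 0 = 0.
Proof. by rewrite /exp_primitive mulr0 expR0 subrr mul0r if_same. Qed.

Lemma Rintegral_expR l h : 0 < h ->
  \int[lebesgue_measure]_(s in `[0, h]) expR (l * (h - s)) =
  expR (l * h) * exp_primitive l h.
Proof.
move=> h0; rewrite /Rintegral.
have H (t : R) :
    is_derive t 1 (expR (l * h) *: exp_primitive l) (expR (l * (h - t))).
  apply: is_derive_eq; first exact: is_deriveZ (is_derive_exp_primitive l t).
  by rewrite /GRing.scale/= -expRD mulNr mulrBr.
have cF : continuous (expR (l * h) *: exp_primitive l).
  move=> t; apply/differentiable_continuous/derivable1_diffP.
  by case: (H t).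
rewrite (continuous_FTC2 (F := expR (l * h) *: exp_primitive l))//=.
- rewrite -[LHS]/(expR (l * h) * exp_primitive l h -
    expR (l * h) * exp_primitive l 0).
  by rewrite exp_primitive0 mulr0 subr0.
- apply: continuous_subspaceT => t.
  apply: continuous_comp; last exact: continuous_expR.
  by apply: cvgM; [exact: cvg_cst|apply: cvgB; [exact: cvg_cst|exact: cvg_id]].
- split=> [t _||].
  + by case: (H t).
  + exact/cvg_at_right_filter/cF.
  + exact/cvg_at_left_filter/cF.
- by move=> t _; rewrite derive1E derive_val.
Qed.

Lemma exp_primitive_ge0 l h : 0 < h -> 0 <= exp_primitive l h.
Proof.
move=> h0; have := Rintegral_expR l h0.
have : 0 <= \int[lebesgue_measure]_(s in `[0, h]) expR (l * (h - s)).
  by apply: Rintegral_ge0 => s _; exact: expR_ge0.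
by move=> /[swap] ->; rewrite pmulr_rge0 ?expR_gt0.
Qed.

(** The norm need not be differentiable where [U] vanishes, so the comparison
    runs on [u = sqrt (|U|^2 + eta^2)], which satisfies
    [u' <= l * u + (eps + |l| * eta)]; then [eta] tends to 0. *)
Lemma gronwall_fnorm m l h eps (U dU : R -> 'M[R]_m) : 0 < h -> 0 <= eps ->
  {within `[0, h], continuous U} ->
  (forall t, 0 < t < h -> is_derive t 1 U (dU t)) ->
  (forall t, 0 < t < h ->
     fdot (U t) (dU t) <= l * fnorm (U t) ^+ 2 + eps * fnorm (U t)) ->
  fnorm (U h) <= expR (l * h) * fnorm (U 0) +
    eps * \int[lebesgue_measure]_(s in `[0, h]) expR (l * (h - s)).
Proof.
move=> h0 eps0 cU U' UdU; rewrite Rintegral_expR//.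
set I := exp_primitive l h; have I0 : 0 <= I by exact: exp_primitive_ge0.
have main eta : 0 < eta -> fnorm (U h) <= expR (l * h) * fnorm (U 0) +
    eps * (expR (l * h) * I) + eta * (expR (l * h) * (1 + `|l| * I)).
  move=> eta0.
  pose u t := Num.sqrt (fdot (U t) (U t) + eta ^+ 2).
  pose c := eps + `|l| * eta.
  have g0 t : 0 < fdot (U t) (U t) + eta ^+ 2.
    by rewrite ltr_wpDl ?fdot_ge0 ?exprn_gt0.
  have u2 t : u t ^+ 2 = fnorm (U t) ^+ 2 + eta ^+ 2.
    by rewrite sqr_sqrtr ?ltW// sqr_fnorm.
  have u0 t : 0 < u t by rewrite sqrtr_gt0.
  have leUu t : fnorm (U t) <= u t.
    rewrite -(@ler_pXn2r _ 2)// ?nnegrE ?fnorm_ge0 ?(ltW (u0 t))//.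
    by rewrite u2 lerDl sqr_ge0.
  have leeu t : eta <= u t.
    rewrite -(@ler_pXn2r _ 2)// ?nnegrE ?(ltW eta0) ?(ltW (u0 t))//.
    by rewrite u2 lerDr sqr_ge0.
  (* The integrating factor turns the differential inequality for [u] into
     monotonicity of [v]. *)
  pose v : R -> R := (fun t => expR (- l * t)) * u - c *: exp_primitive l.
  have v' t : 0 < t < h -> is_derive t 1 v
      (expR (- l * t) * (fdot (U t) (dU t) / u t - l * u t - c)).
    move=> th.
    have du : is_derive t 1 u (fdot (U t) (dU t) / u t).
      have H : is_derive t 1 (fun x => fdot (U x) (U x) + eta ^+ 2)
           (2 * fdot (U t) (dU t)).
        apply: is_derive_eq.
          exact: is_deriveD (is_derive_fdot (U' _ th)) (is_derive_cst _ _ _).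
        by rewrite addr0.
      have := is_derive1_comp (g := fun x => fdot (U x) (U x) + eta ^+ 2)
        (is_derive1_sqrt (g0 t)) H.
      move=> /is_derive_eq; apply.
      by rewrite -/(u t); field; rewrite gt_eqF.
    have dE := is_derive_expRM (- l) t.
    have dP := is_derive_exp_primitive l t.
    apply: is_derive_eq (is_deriveB (is_deriveM dE du) (is_deriveZ c dP)) _.
    by rewrite /GRing.scale/=; ring.
  have cv : {within `[0, h], continuous v}.
    have ce : continuous (fun t : R => expR (- l * t)).
      move=> t; apply/differentiable_continuous/derivable1_diffP.
      by case: (is_derive_expRM (- l) t).
    have cp : continuous (exp_primitive l).
      move=> t; apply/differentiable_continuous/derivable1_diffP.
      by case: (is_derive_exp_primitive l t).
    have cu : {within `[0, h], continuous u}.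
      move=> t; apply: continuous_comp; last exact: sqrt_continuous.
      apply: cvgD; last exact: cvg_cst.
      exact: (continuous_fdot cU).
    move=> t; apply: cvgB.
      by apply: cvgM; [exact: (continuous_subspaceT ce)|exact: cu].
    by apply: cvgZr; exact: (continuous_subspaceT cp).
  have vle : v h <= v 0.
    apply: (@ler0_derive1_le_cc _ v 0 h) => //; rewrite ?in_itv/= ?lexx ?ltW//.
    - by move=> t; rewrite in_itv/= => /v' [].
    - move=> t; rewrite in_itv/= => th; have := v' t th => v't.
      rewrite derive1E derive_val pmulr_rle0 ?expR_gt0//.
      rewrite -addrA -opprD subr_le0 ler_pdivrMr// (le_trans (UdU _ th))//.
      have -> : fnorm (U t) ^+ 2 = u t ^+ 2 - eta ^+ 2 by rewrite u2 addrK.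
      have := leUu t; have := leeu t; have := u0 t.
      have := ler_norm (- l); rewrite normrN => lN ut eu Uu.
      have : eps * fnorm (U t) <= eps * u t by rewrite ler_wpM2l.
      have : - l * eta ^+ 2 <= `|l| * eta * u t.
        apply: (@le_trans _ _ (`|l| * eta ^+ 2)).
          by rewrite ler_wpM2r ?sqr_ge0.
        by rewrite -mulrA ler_wpM2l// expr2 ler_wpM2l ?(ltW eta0).
      rewrite /c; lra.
  have u0le : u 0 <= fnorm (U 0) + eta.
    rewrite -(@ler_pXn2r _ 2)// ?nnegrE ?addr_ge0 ?fnorm_ge0
      ?(ltW eta0) ?(ltW (u0 0))//.
    rewrite u2; have := mulr_ge0 (fnorm_ge0 (U 0)) (ltW eta0); lra.
  move: vle; rewrite /v !fctE mulr0 expR0 mul1r /GRing.scale/=.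
  rewrite exp_primitive0 mulr0 subr0 -/I.
  rewrite lerBlDr mulNr expRN ler_pdivrMl ?expR_gt0// => uh.
  apply: (le_trans (leUu h)); apply: (le_trans uh).
  have := expR_gt0 (l * h); set e := expR _ => e0.
  have : e * u 0 <= e * (fnorm (U 0) + eta) by rewrite ler_pM2l.
  rewrite /c; lra.
apply/ler_addgt0Pr => e e0.
have K0 : 0 < expR (l * h) * (1 + `|l| * I).
  by rewrite mulr_gt0 ?expR_gt0// ltr_pwDl// mulr_ge0.
by have := main _ (divr_gt0 e0 K0); rewrite divfK ?gt_eqF.
Qed.
End Gronwall.

(** * One parareal update along the flows *)

Section Flows.
Context (R : realType) (m : nat).
Implicit Types (F : 'M[R]_m -> 'M[R]_m) (a h T : R).

Lemma is_derive_shift (V : normedModType R) (X : R -> V) a t (dX : V) :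
  is_derive (a + t) 1 X dX -> is_derive t 1 (fun s => X (a + s)) dX.
Proof.
have quotE : (fun h : R => h^-1 *: (((fun s => X (a + s)) \o shift t) (h *: 1)
                        - X (a + t))) =
    (fun h => h^-1 *: ((X \o shift (a + t)) (h *: 1) - X (a + t))).
  by apply/funext => h /=; rewrite addrCA.
by move=> [X' <-]; split; rewrite /derivable /derive quotE.
Qed.

Lemma ode_solution_shift F T a h X : 0 <= a -> a + h <= T ->
  ode_solution F T X -> ode_solution F h (fun t => X (a + t)).
Proof.
move=> a0 ahT [cX dX]; split=> [|t /andP[t0 th]]; last first.
  apply/is_derive_shift/dX.
  by rewrite ltr_wpDl//= (lt_le_trans _ ahT)// ltrD2l.
apply/subspace_continuousP => t /=; rewrite in_itv/= => /andP[t0 th].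
have at0T : `[0, T]%classic (a + t).
  by rewrite /= in_itv/= addr_ge0//= (le_trans _ ahT)// lerD2l.
move/subspace_continuousP : cX => /(_ _ at0T); apply: cvg_trans.
apply: (@cvg_comp _ _ _ (fun s => a + s) X _
  (within `[0, T] (nbhs (a + t)))) => //.
move=> P; rewrite /within/= => nP.
have ca : (fun s => a + s) @ nbhs t --> a + t.
  by apply: cvgD; [exact: cvg_cst|exact: cvg_id].
apply: (@filterS _ (nbhs t) _ _ _ _ (ca _ nP)) => s /= Ps.
rewrite in_itv/= => /andP[s0 sh]; apply: Ps.
by rewrite in_itv/= addr_ge0//= (le_trans _ ahT)// lerD2l.
Qed.

(** The estimates below are proved for arbitrary solutions; this applies them to
    the one that the flow selects. *)
Lemma dlra_flowP p F h Z0 :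
  (exists Z, dlra_solution p F h Z0 Z) ->
  exists2 Z, dlra_solution p F h Z0 Z & Z h = dlra_flow p F h Z0.
Proof.
move=> [Z sZ]; rewrite /dlra_flow; case: xgetP => [W _ //|].
by move/(_ (Z h)) => /=; case; exists Z.
Qed.

(** For an affine map the one-sided Lipschitz condition, taken at 0, is a bound
    on the numerical range of its linear part. *)
Lemma fdot_linear_le F (A : {linear 'M[R]_m -> 'M[R]_m}) B l U :
  (forall Z, F Z = A Z + B) -> one_sided_lipschitz F l ->
  fdot U (A U) <= l * fnorm U ^+ 2.
Proof.
move=> FA /(_ U 0); by rewrite !FA subr0 (linear0 A) [0 + B]add0r addrK.
Qed.

(** The coefficients [1 - 1 - 1 + 1] of the four trajectories sum to zero, so
    their combination solves the linear equation of [A] up to the three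
    modeling errors. *)
Lemma parareal_defect q r F (A : {linear 'M[R]_m -> 'M[R]_m}) B l epsq epsr h
    (X Zr Zq Zq' : R -> 'M[R]_m) zr zq zq' :
  (forall Z, F Z = A Z + B) -> one_sided_lipschitz F l ->
  modeling_error q F epsq -> modeling_error r F epsr -> 0 < h ->
  ode_solution F h X -> dlra_solution r F h zr Zr ->
  dlra_solution q F h zq Zq -> dlra_solution q F h zq' Zq' ->
  fnorm (X h - (Zr h + Zq h - Zq' h)) <=
    expR (l * h) * fnorm (X 0 - (zr + zq - zq')) +
    (2 * epsq + epsr) *
      \int[lebesgue_measure]_(s in `[0, h]) expR (l * (h - s)).
Proof.
move=> FA Fl Fq Fr h0 [cX dX] [<- rkr [cr dr]] [<- rkq [cq dq]]
  [<- rkq' [cq' dq']].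
pose G p W := tangent_proj p W (F W).
pose U := X - (Zr + Zq - Zq').
pose dU t := F (X t) - (G r (Zr t) + G q (Zq t) - G q (Zq' t)).
pose d t := (F (Zr t) - G r (Zr t)) + (F (Zq t) - G q (Zq t))
            - (F (Zq' t) - G q (Zq' t)).
have dUE t : dU t = A (U t) + d t.
  rewrite -[U t]/(X t - (Zr t + Zq t - Zq' t)) /dU /d !FA.
  rewrite (linearB A) (linearB A) (linearD A) /=.
  apply/matrixP => i j; rewrite !mxE; ring.
have d_le t : 0 <= t <= h -> fnorm (d t) <= 2 * epsq + epsr.
  move=> th; have := Fr _ (rkr t th); have := Fq _ (rkq t th).
  have := Fq _ (rkq' t th).
  have := fnormB ((F (Zr t) - G r (Zr t)) + (F (Zq t) - G q (Zq t)))
                 (F (Zq' t) - G q (Zq' t)).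
  have := fnormD (F (Zr t) - G r (Zr t)) (F (Zq t) - G q (Zq t)).
  rewrite -/(d t) /G; lra.
apply: (gronwall_fnorm (U := U) (dU := dU)) => //.
- by apply: le_trans (fnorm_ge0 _) (d_le 0 _); rewrite lexx ltW.
- move=> t; apply: cvgB; first exact: cX.
  apply: cvgB; last exact: cq'.
  by apply: cvgD; [exact: cr|exact: cq].
- move=> t th.
  exact: is_deriveB (dX t th)
    (is_deriveB (is_deriveD (dr t th) (dq t th)) (dq' t th)).
- move=> t /andP[t0 th]; rewrite dUE fdotDr lerD//.
    exact: fdot_linear_le FA Fl.
  rewrite (le_trans (fdot_le_fnormM _ _))// mulrC ler_wpM2r ?fnorm_ge0//.
  by rewrite d_le// !ltW.
Qed.

End Flows.

(** * The error recursion *)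

(** With [K = kappa / (1 - alpha - beta)], the identity
    [K = (alpha + beta) * K + kappa] absorbs the inhomogeneous term, while
    [alpha * (alpha^k (1 + beta)^n) + beta * (alpha^k.+1 (1 + beta)^n)]
    is exactly [alpha^k.+1 (1 + beta)^n.+1]. *)
Lemma double_recursion_bound (R : realFieldType) (N : nat)
    (e : nat -> nat -> R) (alpha beta kappa M : R) :
  0 <= alpha -> 0 <= beta -> alpha + beta < 1 -> 0 <= kappa -> 0 <= M ->
  (forall n, (n < N)%N -> e n.+1 0%N <= M) ->
  (forall k, e 1%N k.+1 <= kappa) ->
  (forall n k, (n.+1 < N)%N ->
     e n.+2 k.+1 <= alpha * e n.+1 k + beta * e n.+1 k.+1 + kappa) ->
  forall n k, (n < N)%N ->
    e n.+1 k <= alpha ^+ k * (1 + beta) ^+ n * M + kappa / (1 - alpha - beta).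
Proof.
move=> a0 b0 ab1 k0 M0 eM e1 eS.
have c0 : 0 < 1 - alpha - beta by lra.
set K := kappa / _.
have KE : kappa = K - (alpha + beta) * K.
  by rewrite /K; field; rewrite gt_eqF.
have K0 : 0 <= K by rewrite divr_ge0// ltW.
have B0 i n : 0 <= alpha ^+ i * (1 + beta) ^+ n * M.
  by rewrite !mulr_ge0 ?exprn_ge0 ?addr_ge0.
elim=> [k N0|n IHn [|k] nN].
- case: k => [|k]; first by rewrite mul1r mul1r (le_trans (eM _ N0))// lerDl.
  apply: (le_trans (e1 k)); have := B0 k.+1 0%N.
  have : 0 <= (alpha + beta) * K by rewrite mulr_ge0 ?addr_ge0.
  lra.
- rewrite expr0 mul1r (le_trans (eM _ nN))// ler_wpDr//.
  by rewrite ler_peMl// exprn_ege1// lerDl.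
- apply: (le_trans (eS _ _ nN)).
  have /(ler_wpM2l a0) := IHn k (ltnW nN).
  have /(ler_wpM2l b0) := IHn k.+1 (ltnW nN).
  rewrite !exprS; lra.
Qed.

(** * The error of low-rank Parareal *)

(* The matrices at which the truncations are compared form the set D; the
   truncated SVD is discontinuous where singular values coincide, so it has no
   finite Lipschitz constant on the whole space. *)
Theorem theorem3p6 (R : realType) (m q r N : nat)
    (A : {linear 'M[R]_m -> 'M[R]_m}) (B : 'M[R]_m) (F : 'M[R]_m -> 'M[R]_m)
    (L l epsq epsr h : R)
    (X0 : 'M[R]_m) (X : R -> 'M[R]_m)
    (Tq Tr : 'M[R]_m -> 'M[R]_m)
    (Y0 : 'M[R]_m) (P : nat -> 'M[R]_m) (Y : nat -> nat -> 'M[R]_m)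
    (D : set 'M[R]_m) (Crq Cq : R)
    (hqr : (q < r)%N) (hN : (0 < N)%N) (hh : 0 < h)
    (F_affine : forall Z, F Z = A Z + B)
    (F_lipschitz : frobenius_lipschitz setT F L)
    (F_one_sided : one_sided_lipschitz F l)
    (F_modeling_q : modeling_error q F epsq)
    (F_modeling_r : modeling_error r F epsr)
    (X_init : X 0 = X0)
    (X_solution : ode_solution F (N%:R * h) X)
    (Tq_truncation : truncation q Tq)
    (Tr_truncation : truncation r Tr)
    (Y_parareal : lowrank_parareal q r N F Tq Tr h Y0 P Y)
    (Y_well_defined : parareal_well_defined q r N F Tq Tr h Y)
    (Y0_consistent : Tr Y0 = Tr X0)
    (D_X : forall n, (n <= N)%N -> D (X (n%:R * h)))
    (D_Y : forall n k, (n <= N)%N -> D (Y n k))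
    (Trq_lipschitz : frobenius_lipschitz D (fun Z => Tr Z - Tq Z) Crq)
    (Tq_lipschitz : frobenius_lipschitz D Tq Cq) :
  let Xn (n : nat) := X (n%:R * h) in
  let E (n k : nat) := Xn n - Y n k in
  let alpha := expR (l * h) * Crq in
  let beta := expR (l * h) * Cq in
  let kappa :=
    expR (l * h) * \big[Num.max/0]_(n < N.+1) fnorm (Xn n - Tr (Xn n)) +
    (2 * epsq + epsr) *
      \int[lebesgue_measure]_(s in `[0, h]) expR (l * (h - s)) in
  alpha + beta < 1 ->
  forall n k : nat, (n <= N)%N -> (0 < n)%N \/ Y0 = X0 ->
    fnorm (E n k) <=
      alpha ^+ k * (1 + beta) ^ (n%:Z - 1) *
        \big[Num.max/0]_(j < N.+1) fnorm (E j 0%N) +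
      kappa / (1 - alpha - beta).
Proof.
move=> Xn E alpha beta kappa ab1 n k nN n0.
set M := \big[Num.max/0]_(j < N.+1) fnorm (E j 0%N).
pose tau := \big[Num.max/0]_(j < N.+1) fnorm (Xn j - Tr (Xn j)).
pose I := \int[lebesgue_measure]_(s in `[0, h]) expR (l * (h - s)).
have [Crq0 TrqP] := Trq_lipschitz; have [Cq0 TqP] := Tq_lipschitz.
have [Yinit _ _ Ystep] := Y_parareal.
have el0 : 0 < expR (l * h) := expR_gt0 _.
have alpha0 : 0 <= alpha by rewrite mulr_ge0// ltW.
have beta0 : 0 <= beta by rewrite mulr_ge0// ltW.
have M0 : 0 <= M by exact: bigmax_ge_id.
have tauP j : (j <= N)%N -> fnorm (Xn j - Tr (Xn j)) <= tau.
  move=> jN.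
  by apply: (le_bigmax 0 (fun i : 'I_N.+1 => fnorm (Xn i - Tr (Xn i)))
    (Ordinal (jN : (j < N.+1)%N))).
have MP j : (j <= N)%N -> fnorm (E j 0%N) <= M.
  by move=> jN; apply: (le_bigmax 0 (fun i : 'I_N.+1 => fnorm (E i 0%N))
    (Ordinal (jN : (j < N.+1)%N))).
have Estep j i : (j < N)%N -> fnorm (E j.+1 i.+1) <= expR (l * h) *
    fnorm (Xn j - (Tr (Y j i) + Tq (Y j i.+1) - Tq (Y j i))) +
    (2 * epsq + epsr) * I.
  move=> jN; rewrite /E Ystep//.
  have [/dlra_flowP[Zr sr <-] /dlra_flowP[Zq' sq' <-]] := Y_well_defined j i jN.
  have [_ /dlra_flowP[Zq sq <-]] := Y_well_defined j i.+1 jN.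
  have Xj : Xn j.+1 = X (j%:R * h + h) by rewrite /Xn -natr1 mulrDl mul1r.
  have Xj0 : Xn j = X (j%:R * h + 0) by rewrite addr0.
  rewrite Xj Xj0.
  apply: (parareal_defect (X := fun t => X (j%:R * h + t))
    F_affine F_one_sided F_modeling_q F_modeling_r hh _ sr sq sq').
  apply: ode_solution_shift X_solution; first by rewrite mulr_ge0// ltW.
  by rewrite -[X in _ + X]mul1r -mulrDl natr1 ler_wpM2r ?ler_nat// ltW.
have E1 i : fnorm (E 1%N i.+1) <= kappa.
  apply: (le_trans (Estep 0%N i hN)); rewrite !Yinit addrK /kappa lerD2r.
  rewrite ler_pM2l//; have -> : Tr Y0 = Tr (Xn 0%N).
    by rewrite Y0_consistent /Xn mul0r X_init.
  exact: tauP.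
have ES j i : (j < N)%N ->
    fnorm (E j.+1 i.+1) <=
      alpha * fnorm (E j i) + beta * fnorm (E j i.+1) + kappa.
  move=> jN; apply: (le_trans (Estep j i jN)).
  have -> : Xn j - (Tr (Y j i) + Tq (Y j i.+1) - Tq (Y j i)) =
    (Xn j - Tr (Xn j)) + ((Tr (Xn j) - Tq (Xn j)) - (Tr (Y j i) - Tq (Y j i)))
    + (Tq (Xn j) - Tq (Y j i.+1)).
    by apply/matrixP => a b; rewrite !mxE; ring.
  rewrite /kappa -/tau -/I [leRHS]addrA lerD2r /alpha /beta.
  rewrite -!mulrA -!mulrDr ler_pM2l//.
  have jN' := ltnW jN.
  have := TrqP _ _ (D_X j jN') (D_Y j i jN').
  have := TqP _ _ (D_X j jN') (D_Y j i.+1 jN').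
  have := tauP j jN'.
  have := fnormD ((Xn j - Tr (Xn j)) +
    ((Tr (Xn j) - Tq (Xn j)) - (Tr (Y j i) - Tq (Y j i))))
    (Tq (Xn j) - Tq (Y j i.+1)).
  have := fnormD (Xn j - Tr (Xn j))
    ((Tr (Xn j) - Tq (Xn j)) - (Tr (Y j i) - Tq (Y j i))).
  rewrite /E /Xn; lra.
have kappa0 : 0 <= kappa by apply: le_trans (fnorm_ge0 _) (E1 0%N).
case: n nN n0 => [_ [//|Y0X0]|n nN _].
  (* At the initial time the exponent of [1 + beta] is -1, so only the sign of
     the right-hand side matters. *)
  have -> : E 0%N k = 0 by rewrite /E Yinit /Xn mul0r X_init Y0X0 subrr.
  rewrite fnorm0 addr_ge0 ?divr_ge0//; last lra.
  by rewrite !mulr_ge0 ?exprn_ge0// exprz_ge0 ?addr_ge0.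
have -> : (n.+1%:Z - 1)%R = n%:Z by rewrite -addn1 PoszD addrK.
apply: (double_recursion_bound (e := fun n k => fnorm (E n k))) nN => //.
- by move=> j jN; exact: MP.
- by move=> j i jN; exact: ES.
Qed.
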